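(* Let $\mathbb{H}$ be the infinite dimensional Heisenberg group equipped with the left invariant weak Riemannian metric $\sigma$ defined in the context. Then there exist two sequences $(a_{1j})_{j\ge1}$, $(a_{2j})_{j\ge1}$ of vectors in $\mathrm{Lie}(\mathbb{H})$ and a vector $b\in\mathrm{Lie}(\mathbb{H})$, such that the vectors $a_{1j},a_{2j}$ ($j\ge1$) and $b$ are orthonormal with respect to $\langle\cdot,\cdot\rangle_\sigma$, the sectional curvatures $K_\sigma(a_{1j},a_{2j})$, $K_\sigma(a_{1j},b)$, $K_\sigma(a_{2j},b)$ are defined for every $j\ge1$, one has $K_\sigma(a_{1j},b)=K_\sigma(a_{2j},b)$ for every $j\ge1$, and $$\lim_{j\to\infty}K_\sigma(a_{1j},a_{2j})=-\infty\qquad\text{and}\qquad\lim_{j\to\infty}K_\sigma(a_{1j},b)=+\infty.$$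
   Context: $\ell^2$ is the Hilbert space of real square-summable sequences with its standard scalar product $\langle\cdot,\cdot\rangle$. The infinite dimensional Heisenberg group $\mathbb{H}$ is the Hilbert space $\ell^2\times\ell^2\times\mathbb{R}$ equipped with the Lie group operation $$(h_1,h_2,\tau)(h_1',h_2',\tau')=(h_1+h_1',\,h_2+h_2',\,\tau+\tau'+\langle h_1,h_2'\rangle-\langle h_2,h_1'\rangle).$$ Its Lie algebra $\mathrm{Lie}(\mathbb{H})$ (left invariant vector fields) is identified with $T_0\mathbb{H}=\ell^2\times\ell^2\times\mathbb{R}$, with Lie product $$[(h_1,h_2,\tau),(h_1',h_2',\tau')]=2\big(\langle h_1,h_2'\rangle-\langle h_2,h_1'\rangle\big)\,(0,0,1).$$ The metric $\sigma$: let $A:\ell^2\to\ell^2$ be the continuous linear operator $(Ax)_k=x_k/k$, $k\ge1$. The left invariant weak Riemannian metric $\sigma$ is the one given at the identity by the scalar product $$\sigma_0((v_1,v_2,v_3),(w_1,w_2,w_3))=\langle Av_1,w_1\rangle+\langle Av_2,w_2\rangle+v_3w_3.$$ The corresponding scalar product on $\mathrm{Lie}(\mathbb{H})$ is $\langle\cdot,\cdot\rangle_\sigma=\sigma_0$. Sectional curvature: for $X,Y\in\mathrm{Lie}(\mathbb{H})$, let $B_\sigma(X,Y)=\mathrm{ad}(Y)^*(X)$ denote the (unique, if it exists) element of $\mathrm{Lie}(\mathbb{H})$ such that $\langle[Y,Z],X\rangle_\sigma=\langle Z,B_\sigma(X,Y)\rangle_\sigma$ for all $Z\in\mathrm{Lie}(\mathbb{H})$.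 Since $\sigma$ is only a weak metric, $B_\sigma(X,Y)$ need not exist. For $X,Y$ orthonormal with respect to $\langle\cdot,\cdot\rangle_\sigma$ such that $B_\sigma(X,Y)$, $B_\sigma(Y,X)$, $B_\sigma(X,X)$, $B_\sigma(Y,Y)$ exist, the sectional curvature of the plane spanned by $X,Y$ is defined (Arnold's formula) as $$K_\sigma(X,Y)=\langle\delta,\delta\rangle_\sigma+2\langle\alpha,\beta\rangle_\sigma-3\langle\alpha,\alpha\rangle_\sigma-4\langle B_X,B_Y\rangle_\sigma,$$ where $\delta=\frac12(B_\sigma(X,Y)+B_\sigma(Y,X))$, $\beta=\frac12(B_\sigma(X,Y)-B_\sigma(Y,X))$, $\alpha=\frac12[X,Y]$, $B_X=\frac12B_\sigma(X,X)$, $B_Y=\frac12B_\sigma(Y,Y)$. *)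

(* Defs.v *)
From HB Require Import structures.
From mathcomp Require Import all_boot all_order all_algebra.
From mathcomp Require Import all_classical all_reals all_analysis.
From mathcomp Require Import ring lra.

Set Implicit Arguments.
Unset Strict Implicit.
Unset Printing Implicit Defensive.

Import Order.TTheory GRing.Theory Num.Theory.
Import numFieldNormedType.Exports.

Local Open Scope classical_set_scope.
Local Open Scope ring_scope.

(** The Hilbert space l^2.  Sequences are indexed from 0: the entry of index
    [k] here is the [k.+1]-st entry of a sequence indexed by k >= 1. *)

Definition square_summable (R : realType) : {pred nat -> R^o} :=
  fun u => `[< cvgn (series (fun k => (u k ^+ 2 : R))) >].

Arguments square_summable {R}.

Lemma square_summableP (R : realType) (u : nat -> R^o) :
  reflect (cvgn (series (fun k => (u k ^+ 2 : R)))) (u \in square_summable).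
Proof. exact: asboolP. Qed.

Lemma square_summable_submod (R : realType) :
  submod_closed (@square_summable R).
Proof.
split=> [|a u v /square_summableP cu /square_summableP cv];
  apply/square_summableP.
  rewrite (_ : series _ = cst 0); first exact: is_cvg_cst.
  by apply/funext => n; rewrite /series /= big1// => k _; rewrite expr0n.
have cD : cvgn (series (fun k => 2 * a ^+ 2 * u k ^+ 2 + 2 * v k ^+ 2 : R)).
  exact (is_cvg_seriesD (is_cvg_seriesZ (k := 2 * a ^+ 2) cu)
    (is_cvg_seriesZ (k := 2) cv)).
apply: series_le_cvg cD => k; first exact: sqr_ge0.
  have := sqr_ge0 (a * u k : R); have := sqr_ge0 (v k : R); lra.
have := sqr_ge0 (a * u k - v k : R).
change (0 <= (a * u k - v k) ^+ 2 ->
  (a * u k + v k) ^+ 2 <= 2 * a ^+ 2 * u k ^+ 2 + 2 * v k ^+ 2 :> R); lra.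
Qed.

HB.instance Definition _ (R : realType) :=
  GRing.isSubmodClosed.Build R (nat -> R^o) (@square_summable R)
    (@square_summable_submod R).

Record ell2 (R : realType) := Ell2 {
  ell2_val :> nat -> R^o ;
  ell2P : ell2_val \in square_summable }.

HB.instance Definition _ (R : realType) := [isSub for @ell2_val R].
HB.instance Definition _ (R : realType) := [Choice of ell2 R by <:].
HB.instance Definition _ (R : realType) :=
  [SubChoice_isSubLmodule of ell2 R by <:].

Section Inner.
Variable R : realType.
Implicit Types x y z : ell2 R.

Definition inner x y : R := limn (series (fun k => (x k * y k : R))).

Lemma cvg_inner x y : cvgn (series (fun k => (x k * y k : R))).
Proof.
have /square_summableP cx := ell2P x; have /square_summableP cy := ell2P y.
apply: normed_cvg; apply: series_le_cvg (is_cvg_seriesD cx cy) => k //=.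
  by rewrite addr_ge0// sqr_ge0.
suff E (a b : R) : `|a * b| <= a ^+ 2 + b ^+ 2 by exact: E.
have := sqr_ge0 (a + b); have := sqr_ge0 (a - b).
have := sqr_ge0 a; have := sqr_ge0 b => *.
by rewrite ler_norml; apply/andP; split; lra.
Qed.

Lemma innerC x y : inner x y = inner y x.
Proof.
by congr (limn (series _)); apply/funext => k; rewrite mulrC.
Qed.

Lemma innerPr (a : R) x y z : inner x (a *: y + z) = a * inner x y + inner x z.
Proof.
rewrite /inner -[a * _]/(a *: _) -lim_seriesZ; last exact: cvg_inner.
rewrite -lim_seriesD; [|exact/is_cvg_seriesZ/cvg_inner|exact: cvg_inner].
congr (limn (series _)); apply/funext => k.
by rewrite /= mulrDr mulrCA.
Qed.

Lemma innerDr x y z : inner x (y + z) = inner x y + inner x z.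
Proof. by rewrite -[y]scale1r innerPr mul1r scale1r. Qed.

Lemma inner0r x : inner x 0 = 0.
Proof. by apply: (addrI (inner x 0)); rewrite -innerDr !addr0. Qed.

Lemma innerZr (a : R) x y : inner x (a *: y) = a * inner x y.
Proof. by rewrite -[a *: y]addr0 innerPr inner0r addr0. Qed.

Lemma innerNr x y : inner x (- y) = - inner x y.
Proof. by rewrite -scaleN1r innerZr mulN1r. Qed.

Lemma innerDl x y z : inner (x + y) z = inner x z + inner y z.
Proof. by rewrite !(innerC _ z) innerDr. Qed.

Lemma inner0l x : inner 0 x = 0.
Proof. by rewrite innerC inner0r. Qed.

Lemma innerNl x y : inner (- x) y = - inner x y.
Proof. by rewrite !(innerC _ y) innerNr. Qed.

End Inner.

Section OperatorA.
Variable R : realType.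

Lemma opA_subproof (x : ell2 R) :
  (fun k => x k / k.+1%:R : R^o) \in square_summable.
Proof.
apply/square_summableP.
have /square_summableP cx := ell2P x.
apply: series_le_cvg cx => k; rewrite ?sqr_ge0//.
rewrite expr_div_n ler_pdivrMr ?exprn_gt0// ler_peMr ?sqr_ge0//.
by rewrite expr_ge1// ler1n.
Qed.

Definition opA (x : ell2 R) : ell2 R := Ell2 (opA_subproof x).

Lemma opA_is_linear : linear opA.
Proof.
move=> a x y; apply/val_inj/funext => k /=.
by rewrite [RHS]/GRing.add /= [in RHS]/GRing.scale /= mulrDl -mulrA.
Qed.

HB.instance Definition _ :=
  GRing.isLinear.Build R (ell2 R) (ell2 R) _ opA opA_is_linear.

Lemma inner_opAC (x y : ell2 R) : inner (opA x) y = inner (opA y) x.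
Proof.
congr (limn (series _)); apply/funext => k /=.
by rewrite mulrAC [RHS]mulrAC (mulrC (x k)).
Qed.

Let term (x : ell2 R) k : R := opA x k * x k.

Let term_ge0 x k : 0 <= term x k.
Proof. by rewrite /term /= mulrAC divr_ge0// -expr2 sqr_ge0. Qed.

Let term_le x k : term x k <= inner (opA x) x.
Proof.
have nd : nondecreasing_seq (series (term x)).
  by apply/nondecreasing_seqP => n; rewrite seriesSr lerDl term_ge0.
have := nondecreasing_cvgn_le nd (@cvg_inner _ (opA x) x) k.+1.
apply: le_trans; rewrite seriesSr lerDr.
by rewrite /series /= sumr_ge0.
Qed.

Lemma inner_opA_ge0 x : 0 <= inner (opA x) x.
Proof. exact: le_trans (term_ge0 x 0) (term_le x 0). Qed.

Lemma inner_opA_eq0 x : inner (opA x) x = 0 -> x = 0.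
Proof.
move=> Ax0; apply/val_inj/funext => k /=.
have : term x k == 0 by rewrite eq_le term_ge0 -Ax0 term_le.
rewrite /term /= mulrAC mulf_eq0 invr_eq0 pnatr_eq0 orbF mulf_eq0 orbb.
by move/eqP.
Qed.

End OperatorA.

(** The Heisenberg group, as a set the vector space l^2 x l^2 x R; this space
    is also its tangent space at every point. *)

Definition heis (R : realType) : Type := (ell2 R * ell2 R * R^o)%type.

Section Heisenberg.
Variable R : realType.
Implicit Types g h v w X Y Z W : heis R.

Definition omega v w : R := inner v.1.1 w.1.2 - inner v.1.2 w.1.1.

Definition heis_mul g h : heis R :=
  (g.1.1 + h.1.1, g.1.2 + h.1.2, g.2 + h.2 + omega g h).

Lemma omegaDl g h v : omega (g + h) v = omega g v + omega h v.
Proof. by rewrite /omega /= !innerDl opprD addrACA. Qed.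

Lemma omegaDr g h v : omega v (g + h) = omega v g + omega v h.
Proof. by rewrite /omega /= !innerDr opprD addrACA. Qed.

Lemma omegaNl g v : omega (- g) v = - omega g v.
Proof. by rewrite /omega /= !innerNl opprD. Qed.

Lemma omegaC g v : omega g v = - omega v g.
Proof. by rewrite /omega opprB (innerC g.1.1) (innerC g.1.2). Qed.

Lemma omega_diag g : omega g g = 0.
Proof. by rewrite /omega innerC subrr. Qed.

Lemma omega0l g : omega 0 g = 0.
Proof. by rewrite /omega /= !inner0l subrr. Qed.

Lemma heis_mulE g h : heis_mul g h = g + h + (0, 0, omega g h).
Proof. by congr (_, _, _); rewrite /= addr0. Qed.

Lemma heis_mulA : associative heis_mul.
Proof.
move=> [[g1 g2] g3] [[h1 h2] h3] [[k1 k2] k3]; rewrite /heis_mul /omega /=.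
by congr (_, _, _); rewrite ?addrA// !innerDl !innerDr; ring.
Qed.

Lemma heis_mul0 : left_id 0 heis_mul.
Proof.
by move=> [[g1 g2] g3]; rewrite /heis_mul omega0l addr0 /= !add0r.
Qed.

Lemma heis_mulN : left_inverse 0 -%R heis_mul.
Proof.
by move=> g; rewrite heis_mulE omegaNl omega_diag oppr0 addr0 addNr.
Qed.

(** The differential of the left translation by [g], which is an affine map. *)
Definition dL g v : heis R := (v.1.1, v.1.2, v.2 + omega g v).

Lemma heis_mul_dL g h v : heis_mul g (h + v) = heis_mul g h + dL g v.
Proof.
by rewrite /heis_mul /dL omegaDr /=; congr (_, _, _); rewrite /= ?addrA//; ring.
Qed.

Definition lie_bracket X Y : heis R := (2 * omega X Y) *: (0, 0, 1).

(** [g |-> dL g Y] is the left invariant vector field with value [Y] at the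
    identity; it is affine in [g], with linear part [g |-> dL g Y - Y]. *)
Lemma lie_bracketE X Y : lie_bracket X Y = (dL X Y - Y) - (dL Y X - X).
Proof.
rewrite /lie_bracket /dL (omegaC Y); case: X Y => [[x1 x2] x3] [[y1 y2] y3] /=.
congr (_, _, _) => /=; rewrite ?scaler0 ?subrr//.
by rewrite /GRing.scale /=; ring.
Qed.

Definition sigma0 v w : R :=
  inner (opA v.1.1) w.1.1 + inner (opA v.1.2) w.1.2 + v.2 * w.2.

Definition sigma g v w : R := sigma0 (dL (- g) v) (dL (- g) w).

Lemma sigma_at0 v w : sigma 0 v w = sigma0 v w.
Proof. by rewrite /sigma /sigma0 /dL oppr0 !omega0l !addr0. Qed.

Lemma sigma_left_invariant g h v w :
  sigma (heis_mul g h) (dL g v) (dL g w) = sigma h v w.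
Proof.
have E u : dL (- heis_mul g h) (dL g u) = dL (- h) u.
  rewrite /dL /=; congr (_, _, _).
  by rewrite !omegaNl /omega /= !innerDl; ring.
by rewrite /sigma !E.
Qed.

Lemma sigma0Br v w w' : sigma0 v (w - w') = sigma0 v w - sigma0 v w'.
Proof. by rewrite /sigma0 /= !innerDr !innerNr; ring. Qed.

Lemma sigma0_eq0 v : sigma0 v v = 0 -> v = 0.
Proof.
case: v => [[v1 v2] v3] /eqP; rewrite /sigma0 /= -expr2.
rewrite !paddr_eq0 ?addr_ge0 ?inner_opA_ge0 ?sqr_ge0// sqrf_eq0.
by case/andP => /andP[/eqP/inner_opA_eq0 -> /eqP/inner_opA_eq0 ->] /eqP ->.
Qed.

Definition is_ad_adjoint X Y W :=
  forall Z, sigma0 (lie_bracket Y Z) X = sigma0 Z W.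

Lemma is_ad_adjoint_unique X Y W W' :
  is_ad_adjoint X Y W -> is_ad_adjoint X Y W' -> W = W'.
Proof.
move=> h h'; apply/eqP; rewrite -subr_eq0; apply/eqP/sigma0_eq0.
by rewrite sigma0Br -h -h' subrr.
Qed.

Definition ad_adjoint_exists X Y := exists W, is_ad_adjoint X Y W.

(** [ad(Y)^*(X)]; its value is 0 when [ad(Y)^*(X)] does not exist. *)
Definition ad_adjoint X Y : heis R := xget 0 [set W | is_ad_adjoint X Y W].

Definition orthonormal_family (I : eqType) (e : I -> heis R) :=
  forall i j, sigma0 (e i) (e j) = (i == j)%:R.

Definition curvature_defined X Y :=
  [/\ orthonormal_family (fun i : bool => if i then Y else X),
      ad_adjoint_exists X Y, ad_adjoint_exists Y X,
      ad_adjoint_exists X X & ad_adjoint_exists Y Y].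

(** Arnold's formula, meaningful when [curvature_defined X Y] holds. *)
Definition sectional_curvature X Y : R :=
  let delta : heis R := 2^-1 *: (ad_adjoint X Y + ad_adjoint Y X) in
  let beta : heis R := 2^-1 *: (ad_adjoint X Y - ad_adjoint Y X) in
  let alpha : heis R := 2^-1 *: lie_bracket X Y in
  let BX : heis R := 2^-1 *: ad_adjoint X X in
  let BY : heis R := 2^-1 *: ad_adjoint Y Y in
  sigma0 delta delta + 2 * sigma0 alpha beta - 3 * sigma0 alpha alpha
    - 4 * sigma0 BX BY.

Definition frame (a1 a2 : nat -> heis R) (b : heis R)
    (i : nat + nat + unit) : heis R :=
  match i with
  | inl (inl j) => a1 j
  | inl (inr j) => a2 j
  | inr _ => b
  end.

End Heisenberg.

(* Main.v *)
Require Import Defs.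
From mathcomp Require Import all_boot all_order all_algebra.
From mathcomp Require Import all_classical all_reals all_analysis.
From mathcomp Require Import ring lra.

Import Order.TTheory GRing.Theory Num.Theory.
Import numFieldNormedType.Exports.

Local Open Scope classical_set_scope.
Local Open Scope ring_scope.

(* Let [e n] be the standard basis of l^2, indexed from 1, and take
    [a1 = (sqrt n e_n, 0, 0)], [a2 = (0, sqrt n e_n, 0)], [b = (0, 0, 1)].
    The factor [sqrt n] normalises these vectors for [sigma], but makes
    [[a1, a2] = 2 n b] grow.  Only the vertical part of [X] enters
    [ad(Y)^*(X)], so the adjoints vanish on a pair of horizontal vectors and
    [K(a1, a2) = - 3 n^2], while [ad(a1)^*(b) = 2 n a2] and
    [ad(a2)^*(b) = - 2 n a1] give [K(a1, b) = K(a2, b) = n^2]. *)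

Section Basis.
Context {R : realType}.
Implicit Types (x : ell2 R) (j k : nat).

Let basis_seq j : nat -> R^o := fun k => (k == j)%:R.

(** The partial sums are constant from index [j.+1] on. This gives both summability of the basis
    sequences and the value of [inner] against them. *)
Lemma series_single (f : nat -> R) j :
  series (fun k => f k * (k == j)%:R) @ \oo --> f j.
Proof.
apply: cvg_near_cst; exists j.+1 => // n /= jn.
rewrite /series /= big_mkord (bigD1 (Ordinal jn))//= eqxx mulr1.
rewrite big1 ?addr0// => i; rewrite -val_eqE /= => /negPf ->.
by rewrite mulr0.
Qed.

Lemma basis_subproof j : basis_seq j \in square_summable.
Proof.
apply/square_summableP/cvg_ex; exists 1.
(* An indicator equals its own square. *)
rewrite (_ : (fun k => _) = (fun k => 1 * (k == j)%:R)).
  exact: (series_single (fun=> 1)).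
apply/funext => k; rewrite /basis_seq mul1r.
by case: eqP => _; rewrite ?expr1n ?expr0n.
Qed.

Definition basis j : ell2 R := Ell2 (basis_subproof j).

Lemma inner_basis x j : inner x (basis j) = x j.
Proof. exact/cvg_lim/(series_single x). Qed.

Lemma inner_opA_basis x j : inner (opA x) (basis j) = x j / j.+1%:R.
Proof. by rewrite inner_basis. Qed.

End Basis.

Section Curvature.
Context {R : realType}.
Implicit Types X Y Z W : heis R.

Lemma sigma0C X Y : sigma0 X Y = sigma0 Y X.
Proof.
by rewrite /sigma0 (inner_opAC X.1.1) (inner_opAC X.1.2) (mulrC X.2).
Qed.

Lemma sigma0Zr (c : R) X Y : sigma0 X (c *: Y) = c * sigma0 X Y.
Proof. by rewrite /sigma0 /= !innerZr /GRing.scale /=; ring. Qed.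

Lemma sigma0Zl (c : R) X Y : sigma0 (c *: X) Y = c * sigma0 X Y.
Proof. by rewrite sigma0C sigma0Zr sigma0C. Qed.

Lemma sigma00 X : sigma0 X 0 = 0.
Proof. by rewrite -(scale0r X) sigma0Zr mul0r. Qed.

Definition center_vec : heis R := (0, 0, 1).

Lemma sigma0_center X : sigma0 center_vec X = X.2.
Proof. by rewrite /sigma0 /= linear0 !inner0l !add0r mul1r. Qed.

Lemma lie_bracket_center X Y : lie_bracket X Y = (2 * omega X Y) *: center_vec.
Proof. by []. Qed.

Lemma omega_center X : omega X center_vec = 0.
Proof. by rewrite /omega /= !inner0r subrr. Qed.

(** Brackets are vertical, so pairing with [X] only sees [X.2]. The equation defining [ad(Y)^*(X)]
    thus becomes [2 * omega Y Z * X.2 = sigma0 Z W] for all [Z]. *)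
Lemma sigma0_lie_bracket X Y Z :
  sigma0 (lie_bracket Y Z) X = 2 * omega Y Z * X.2.
Proof. by rewrite lie_bracket_center sigma0Zl sigma0_center. Qed.

(** Uniqueness of the adjoint forces the value chosen by [xget] to agree with any exhibited
    solution. *)
Lemma ad_adjointE X Y W : is_ad_adjoint X Y W -> ad_adjoint X Y = W.
Proof.
move=> adW; rewrite /ad_adjoint; case: xgetP => [_ -> /=|/(_ W)//].
by move=> /is_ad_adjoint_unique; apply.
Qed.

Lemma is_ad_adjoint_horizontal X Y : X.2 = 0 -> is_ad_adjoint X Y 0.
Proof. by move=> X0 Z; rewrite sigma0_lie_bracket X0 mulr0 sigma00. Qed.

Lemma is_ad_adjoint_center X : is_ad_adjoint X center_vec 0.
Proof.
move=> Z.
by rewrite sigma0_lie_bracket omegaC (omega_center Z) oppr0 mulr0 mul0r sigma00.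
Qed.

(** All four adjoints vanish, so only the term in [alpha = omega X Y *: center_vec] survives in
    Arnold's formula. *)
Lemma sectional_curvature_horizontal X Y : X.2 = 0 -> Y.2 = 0 ->
  sectional_curvature X Y = - 3 * omega X Y ^+ 2.
Proof.
move=> X0 Y0.
rewrite /sectional_curvature.
rewrite !(ad_adjointE _ _ _ (is_ad_adjoint_horizontal _ _ _))//.
rewrite subr0 addr0 !scaler0 !sigma00 lie_bracket_center scalerA.
by rewrite sigma0Zl sigma0Zr sigma0_center /=; field.
Qed.

(** Centrality gives [alpha = 0], and [W] is the only adjoint not known to be zero; what remains is
    the norm of [delta = W / 2]. *)
Lemma sectional_curvature_center X W : X.2 = 0 ->
  is_ad_adjoint center_vec X W ->
  sectional_curvature X center_vec = sigma0 W W / 4.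
Proof.
move=> X0 adW.
rewrite /sectional_curvature (ad_adjointE _ _ _ adW).
rewrite !(ad_adjointE _ _ _ (is_ad_adjoint_horizontal _ _ X0)).
rewrite (ad_adjointE _ _ _ (is_ad_adjoint_center _)).
rewrite lie_bracket_center omega_center mulr0 scale0r !scaler0 add0r !sigma00.
by rewrite sigma0Zl sigma0Zr sigma0C sigma00; field.
Qed.

End Curvature.

Section Frame.
Context {R : realType}.
Implicit Types (j : nat) (Z : heis R).

(** Indices start at 0, so the integer [n] of the overview is [j.+1]. *)
Definition frame1 j : heis R := (Num.sqrt j.+1%:R *: basis j, 0, 0).

Definition frame2 j : heis R := (0, Num.sqrt j.+1%:R *: basis j, 0).

Lemma basisZ_val (c : R) i j : (c *: basis i) j = c * (j == i)%:R.
Proof. by []. Qed.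

Lemma sigma0_frame1 Z j :
  sigma0 Z (frame1 j) = Num.sqrt j.+1%:R * (Z.1.1 j / j.+1%:R).
Proof.
by rewrite /sigma0 /= innerZr inner_opA_basis inner0r mulr0 !addr0.
Qed.

Lemma sigma0_frame2 Z j :
  sigma0 Z (frame2 j) = Num.sqrt j.+1%:R * (Z.1.2 j / j.+1%:R).
Proof.
by rewrite /sigma0 /= innerZr inner_opA_basis inner0r mulr0 addr0 add0r.
Qed.

Lemma sqrt_basis_norm i j :
  Num.sqrt j.+1%:R * ((Num.sqrt i.+1%:R *: basis i) j / j.+1%:R)
  = (i == j)%:R :> R.
Proof.
rewrite basisZ_val eq_sym; case: (eqVneq i j) => [->|_]; last first.
  by rewrite mulr0 mul0r mulr0.
by rewrite mulr1 mulrA -expr2 sqr_sqrtr ?ler0n// divff.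
Qed.

Lemma frame_orthonormal : orthonormal_family (frame frame1 frame2 center_vec).
Proof.
move=> [[i|i]|[]] [[j|j]|[]] /=.
- by rewrite sigma0_frame1 sqrt_basis_norm.
- by rewrite sigma0_frame2 mul0r mulr0.
- by rewrite sigma0C sigma0_center.
- by rewrite sigma0_frame1 mul0r mulr0.
- by rewrite sigma0_frame2 sqrt_basis_norm.
- by rewrite sigma0C sigma0_center.
- by rewrite sigma0_center.
- by rewrite sigma0_center.
- by rewrite sigma0_center.
Qed.

Lemma omega_frame1 Z j : omega (frame1 j) Z = Num.sqrt j.+1%:R * Z.1.2 j.
Proof. by rewrite /omega /= innerC innerZr inner_basis inner0l subr0. Qed.

Lemma omega_frame2 Z j : omega (frame2 j) Z = - (Num.sqrt j.+1%:R * Z.1.1 j).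
Proof.
by rewrite /omega /= (innerC (_ *: _)) innerZr inner_basis inner0l sub0r.
Qed.

Lemma omega_frame12 j : omega (frame1 j) (frame2 j) = j.+1%:R.
Proof.
by rewrite omega_frame1 basisZ_val eqxx mulr1 -expr2 sqr_sqrtr ?ler0n.
Qed.

(** The solution exists because the functional to represent is a multiple of the coordinate
    [Z.1.2 j], and [basis j] is an eigenvector of [opA]; the factor [j.+1] undoes the eigenvalue. *)
Lemma is_ad_adjoint_frame1 j :
  is_ad_adjoint center_vec (frame1 j) ((2 * j.+1%:R) *: frame2 j).
Proof.
move=> Z; rewrite sigma0_lie_bracket omega_frame1 sigma0Zr sigma0_frame2 /=.
by field; rewrite nat1r pnatr_eq0.
Qed.

Lemma is_ad_adjoint_frame2 j :
  is_ad_adjoint center_vec (frame2 j) ((- (2 * j.+1%:R)) *: frame1 j).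
Proof.
move=> Z; rewrite sigma0_lie_bracket omega_frame2 sigma0Zr sigma0_frame1 /=.
by field; rewrite nat1r pnatr_eq0.
Qed.

Lemma curvature_defined_frame (i j : nat + nat + unit) : i != j ->
  let e := frame frame1 frame2 center_vec in
  ad_adjoint_exists (e i) (e j) -> ad_adjoint_exists (e j) (e i) ->
  curvature_defined (e i) (e j).
Proof.
move=> ij e eij eji.
(* The diagonal adjoints are zero: each frame vector is either horizontal or central. *)
have self k : ad_adjoint_exists (e k) (e k).
  exists 0; case: k => [[k|k]|[]]; try exact: is_ad_adjoint_horizontal.
  exact: is_ad_adjoint_center.
split => // -[] []; rewrite frame_orthonormal ?eqxx//.
  by rewrite eq_sym (negPf ij).
by rewrite (negPf ij).
Qed.

Lemma curvature_frame12 j :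
  sectional_curvature (frame1 j) (frame2 j) = - 3 * j.+1%:R ^+ 2.
Proof. by rewrite sectional_curvature_horizontal// omega_frame12. Qed.

Lemma curvature_frame1_center j :
  sectional_curvature (frame1 j) center_vec = j.+1%:R ^+ 2.
Proof.
rewrite (sectional_curvature_center _ _ _ (is_ad_adjoint_frame1 j))//.
rewrite sigma0Zl sigma0Zr (frame_orthonormal (inl (inr j)) (inl (inr j))) eqxx.
by rewrite mulr1; field.
Qed.

Lemma curvature_frame2_center j :
  sectional_curvature (frame2 j) center_vec = j.+1%:R ^+ 2.
Proof.
rewrite (sectional_curvature_center _ _ _ (is_ad_adjoint_frame2 j))//.
rewrite sigma0Zl sigma0Zr (frame_orthonormal (inl (inl j)) (inl (inl j))) eqxx.
by rewrite mulr1; field.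
Qed.

Lemma le_sqr_succ j : j%:R <= j.+1%:R ^+ 2 :> R.
Proof.
by rewrite -natrX ler_nat (leq_trans (leqnSn j))// leq_pmulr.
Qed.

End Frame.

Theorem theorem1p3 (R : realType) :
  exists (a1 a2 : nat -> heis R) (b : heis R),
    [/\ orthonormal_family (frame a1 a2 b),
        forall j, [/\ curvature_defined (a1 j) (a2 j),
                      curvature_defined (a1 j) b
                    & curvature_defined (a2 j) b],
        forall j, sectional_curvature (a1 j) b = sectional_curvature (a2 j) b,
        sectional_curvature (a1 j) (a2 j) @[j --> \oo] --> -oo
      & sectional_curvature (a1 j) b @[j --> \oo] --> +oo].
Proof.
have sqr_pinfty : (j.+1%:R ^+ 2 : R) @[j --> \oo] --> +oo.
  apply: ger_cvgy (@cvgr_idn R).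
  by apply: nearW => j; exact: le_sqr_succ.
exists frame1, frame2, center_vec; split.
- exact: frame_orthonormal.
- move=> j; split.
  + apply: (curvature_defined_frame (inl (inl j)) (inl (inr j))) => //=;
      by exists 0; exact: is_ad_adjoint_horizontal.
  + apply: (curvature_defined_frame (inl (inl j)) (inr tt)) => //=.
      by exists 0; exact: is_ad_adjoint_horizontal.
    by eexists; exact: is_ad_adjoint_frame1.
  + apply: (curvature_defined_frame (inl (inr j)) (inr tt)) => //=.
      by exists 0; exact: is_ad_adjoint_horizontal.
    by eexists; exact: is_ad_adjoint_frame2.
- by move=> j; rewrite curvature_frame1_center curvature_frame2_center.
- under eq_fun do rewrite curvature_frame12.
  (* After a change of sign, [3 * j.+1 ^+ 2] dominates [j.+1 ^+ 2], which diverges. *)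
  apply/cvgNry; apply: ger_cvgy sqr_pinfty.
  apply: nearW => j /=.
  by rewrite opprfctE; have := sqr_ge0 (j.+1%:R : R); lra.
- by under eq_fun do rewrite curvature_frame1_center.
Qed.
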